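(* Suppose that $(Y,X)$, with $Y=(Y_1,Y_2)$ and $X=(X_1,X_2)$, follows the two-period model $$Y_t=h_t(Y_t^* )=h_t(\alpha+X_t\beta-U_t),\qquad U_t\mid\alpha,X\sim F_t(u\mid\alpha,X),\qquad t=1,2,$$ and let the distribution of $(Y,X)$ be observed. Suppose that: (A1) for each $t$, the transformation $h_t:\mathcal{Y}^*\to\mathcal{Y}$ is unknown, non-decreasing, right continuous, and non-constant; (A2) (i) $F_1(u\mid\alpha,X)=F_2(u\mid\alpha,X)\equiv F(u\mid\alpha,X)$ for all $(\alpha,X)$; (ii) the support of $F(u\mid\alpha,X)$ is $\mathbb{R}$ for all $(\alpha,X)$; (A3) with $\Delta X=X_2-X_1$ and $W=(\Delta X,-1)$: (i) the distribution of $\Delta X$ is such that at least one component of $\Delta X$ has positive Lebesgue density on $\mathbb{R}$ conditional on all the other components of $\Delta X$ with probability one, and the corresponding component of $\beta$ is non-zero; (ii) the support of $W$ is not contained in any proper linear subspace of $\mathbb{R}^{K+1}$; (A4) for any $(y_1,y_2)\in\underline{\mathcal{Y}}^2$, $\theta(y_1,y_2)\equiv(\beta,\gamma(y_1,y_2))\in\Theta=\mathcal{B}\times\mathbb{R}$, where $\mathcal{B}=\{\beta:\beta\in\mathbb{R}^K,\ \|\beta\|=1\}$ and $\gamma(y_1,y_2)\equiv h_2^-(y_2)-h_1^-(y_1)$. Then, for an arbitrary pair $(y_1,y_2)\in\underline{\mathcal{Y}}^2$, $\theta(y_1,y_2)$ is identified.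
   Context: Here $\alpha$ is an unobserved real random variable (fixed effect), $X_t$ is an observed random $1\times K$ row vector, $\beta\in\mathbb{R}^K$ is an unknown coefficient, $U_t$ is an unobserved error, and $F_t(u\mid\alpha,X)$ is its conditional distribution given $(\alpha,X)$. The supports of $Y_t$, $Y_t^*$ and $X_t$ are denoted $\mathcal{Y}\subseteq\mathbb{R}$, $\mathcal{Y}^*=\mathbb{R}$ and $\mathcal{X}\subseteq\mathbb{R}^K$, respectively (the supports may be indexed by $t$). Set $\underline{\mathcal{Y}}\equiv\mathcal{Y}\setminus\{\inf\mathcal{Y}\}$. The generalized inverse $h_t^-:\mathcal{Y}\to\mathcal{Y}^*$ of $h_t$ is $h_t^-(y)\equiv\inf\{y^*\in\mathcal{Y}^*: y\le h_t(y^* )\}$, with the convention $\inf(\emptyset)=\inf(\mathcal{Y})$. ''Identified'' has its usual meaning: any two structures (values of $\beta,h_1,h_2$ together with a joint distribution of $(\alpha,X,U_1,U_2)$) that satisfy the model and all the stated assumptions and generate the same distribution of $(Y,X)$ give the same value of the object in question.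
   Formalization: The support of Y_t is taken to be the set of values of h_t rather than its closure: at a supremum that h_t does not attain, the generalized inverse is set by the convention inf(∅)=inf(Y) and γ is not identified (e.g. h_1=h_2=arctan, y_1=0, y_2=π/2). *)

(* Defs.v *)
From HB Require Import structures.
From mathcomp Require Export all_boot all_order all_algebra.
From mathcomp Require Export all_classical all_reals all_analysis.
Export numFieldNormedType.Exports.

Set Implicit Arguments.
Unset Strict Implicit.
Unset Printing Implicit Defensive.

Import Order.TTheory GRing.Theory Num.Theory.

Local Open Scope classical_set_scope.
Local Open Scope ring_scope.

(* R^n carries the sigma-algebra generated by its coordinates, which is its
   Borel sigma-algebra. *)
Definition measure_row_display : measure_display -> measure_display.
Proof. exact. Qed.

Section measurable_row.
Context {d} {T : sigmaRingType d}.
Variable n : nat.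

Let coors : 'I_n -> 'rV[T]_n -> T := fun i x => x ord0 i.

Let row_set0 : g_sigma_preimage coors set0.
Proof. exact: sigma_algebra0. Qed.

Let row_setC A : g_sigma_preimage coors A -> g_sigma_preimage coors (~` A).
Proof. exact: sigma_algebraC. Qed.

Let row_bigcup (F : (set 'rV[T]_n)^nat) :
  (forall i, g_sigma_preimage coors (F i)) ->
  g_sigma_preimage coors (\bigcup_i (F i)).
Proof. exact: sigma_algebra_bigcup. Qed.

HB.instance Definition _ := @isMeasurable.Build (measure_row_display d)
  'rV[T]_n (g_sigma_preimage coors) row_set0 row_setC row_bigcup.

End measurable_row.

(* Topological support: the points all of whose open neighbourhoods are
   charged. *)
Definition msupport (R : realType) (T : topologicalType)
    (mu : set T -> \bar R) : set T :=
  [set x | forall A, open_nbhs x A -> (0 < mu A)%E].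

(* The kernel F is a (regular) version of the conditional distribution of V
   given Z under P:  P(Z \in A, V \in B) = E[1_{Z \in A} F(Z, B)]. *)
Definition is_cond_law (R : realType) d d1 d2 (T : measurableType d)
    (T1 : measurableType d1) (T2 : measurableType d2) (P : probability T R)
    (Z : T -> T1) (V : T -> T2) (F : R.-pker T1 ~> T2) : Prop :=
  forall (A : set T1) (B : set T2), measurable A -> measurable B ->
    P ((Z @^-1` A) `&` (V @^-1` B)) = (\int[P]_(w in Z @^-1` A) F (Z w) B)%E.

Inductive period := T1 | T2.

(* An outcome is a realization ((alpha, (X_1, X_2)), (U_1, U_2)). *)
Definition outcome (R : realType) (K : nat) : Type :=
  (R * ('rV[R]_K * 'rV[R]_K) * (R * R))%type.

Record flt_structure (R : realType) (K : nat) := FLTStructure {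
  beta : 'cV[R]_K ;
  h : period -> R -> R ;
  law : probability (R * ('rV[R]_K * 'rV[R]_K) * (R * R))%type R }.

Section model.
Context {R : realType} {K : nat}.
Implicit Types (s : flt_structure R K) (w : outcome R K) (t : period).

Definition alpha w : R := w.1.1.
Definition X t w : 'rV[R]_K :=
  match t with T1 => w.1.2.1 | T2 => w.1.2.2 end.
Definition U t w : R := match t with T1 => w.2.1 | T2 => w.2.2 end.
Definition alphaX w : R * ('rV[R]_K * 'rV[R]_K) := (alpha w, (X T1 w, X T2 w)).

Definition Ystar s t w : R :=
  alpha w + (X t w *m beta s) ord0 ord0 - U t w.
Definition Y s t w : R := h s t (Ystar s t w).

Definition YX s w : (R * R) * ('rV[R]_K * 'rV[R]_K) :=
  ((Y s T1 w, Y s T2 w), (X T1 w, X T2 w)).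

Definition obs_law s : set ((R * R) * ('rV[R]_K * 'rV[R]_K)) -> \bar R :=
  pushforward (law s) (YX s).

Definition obs_equiv s s' : Prop :=
  forall A, measurable A -> obs_law s A = obs_law s' A.

(* The support of Y_t, understood as the set of values that Y_t can take: as
   the support of Y_t^* is the whole line, this is the image of h_t.  With its
   closure, a supremum that h_t does not reach (h_t = atan, say) would be a
   support point at which the generalized inverse is set by convention and
   gamma is not invariant under a common shift of alpha, h_1 and h_2. *)
Definition Ysupp s t : set R := range (h s t).

(* Infima are taken in the extended reals since Ysupp may be unbounded below,
   where the real-valued inf is 0 by default. *)
Definition inf_Ysupp s t : \bar R := ereal_inf (EFin @` Ysupp s t).

Definition Yunder s t : set R := [set y | Ysupp s t y /\ y%:E <> inf_Ysupp s t].

Definition ginv s t (y : R) : \bar R :=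
  let A := [set ystar | y <= h s t ystar] in
  if pselect (A = set0) then inf_Ysupp s t else ereal_inf (EFin @` A).

Definition gamma s (y1 y2 : R) : \bar R := (ginv s T2 y2 - ginv s T1 y1)%E.

Definition theta s (y1 y2 : R) : 'cV[R]_K * \bar R := (beta s, gamma s y1 y2).

Definition A1 s : Prop := forall t,
  [/\ {homo h s t : x y / x <= y},
      right_continuous (h s t) &
      ~ exists c, forall x, h s t x = c].

Definition A2 s : Prop :=
  exists F : period -> R.-pker (R * ('rV[R]_K * 'rV[R]_K)) ~> R,
  [/\ forall t, is_cond_law (law s) alphaX (U t) (F t),
      forall ax, F T1 ax = F T2 ax :> (set R -> \bar R) &
      forall t ax, msupport (F t ax : set R -> \bar R) = [set: R]].

Definition DeltaX w : 'rV[R]_K := X T2 w - X T1 w.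

Definition W w : 'rV[R]_(K + 1) := row_mx (DeltaX w) (const_mx (-1)).

(* col' k v is v without its k-th component. *)
Definition A3i s : Prop :=
  exists k : 'I_K, beta s k ord0 != 0 /\
  exists G : R.-pker 'rV[R]_K.-1 ~> R,
    is_cond_law (law s) (fun w => col' k (DeltaX w))
      (fun w => DeltaX w ord0 k) G /\
    {ae law s, forall w, exists g : R -> R,
      [/\ measurable_fun setT g,
          forall x, 0 < g x &
          forall B, measurable B ->
            G (col' k (DeltaX w)) B
            = (\int[@lebesgue_measure R]_(x in B) (g x)%:E)%E]}.

Definition A3ii s : Prop :=
  forall V : {vspace 'rV[R]_(K + 1)}, V <> fullv ->
    ~ msupport (pushforward (law s) W) `<=` [set v | v \in V].

Definition A3 s : Prop := A3i s /\ A3ii s.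

Definition euclid_norm (b : 'cV[R]_K) : R :=
  Num.sqrt (\sum_(j < K) b j ord0 ^+ 2).

Definition Theta : set ('cV[R]_K * \bar R) :=
  [set b | euclid_norm b = 1] `*` [set c | exists r : R, c = r%:E].

Definition A4 s : Prop := forall y1 y2,
  Yunder s T1 y1 -> Yunder s T2 y2 -> Theta (theta s y1 y2).

Definition admissible s : Prop := [/\ A1 s, A2 s, A3 s & A4 s].

(* The feature q is identified at the true structure s: every admissible
   structure that generates the same distribution of (Y, X) agrees with s
   on q. *)
Definition identified_at (Q : Type) s (q : flt_structure R K -> Q) : Prop :=
  forall s', admissible s' -> obs_equiv s' s -> q s' = q s.

End model.

(* Main.v *)
Require Import Defs.
From mathcomp Require Import ring lra measurable_realfun.

(* For thresholds (y1, y2) put c_t = h_t^-(y_t).  Given (alpha, X), the events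
   {Y_t >= y_t} = {U_t <= alpha + X_t beta - c_t} involve the same strictly
   increasing distribution function, so P(Y_2 >= y_2 | X) - P(Y_1 >= y_1 | X)
   has the sign of Delta X beta - gamma = W theta.  Hence two observationally
   equivalent structures satisfy sgn(W theta) = sgn(W theta') almost surely.
   As a component of Delta X with a nonzero coefficient has, given the others, a
   law charging every interval, W theta and W theta' must be positive multiples
   of one another by a constant; the rank condition on W and the normalization
   of beta then give theta = theta'. *)

Set Implicit Arguments.
Unset Strict Implicit.
Unset Printing Implicit Defensive.

Import Order.TTheory GRing.Theory Num.Theory.

Local Open Scope classical_set_scope.
Local Open Scope ring_scope.

(** * Measurability of comparison events and preimages *)

Lemma measurable_set_ltr (R : realType) d (T : measurableType d) (f g : T -> R) :
  measurable_fun setT f -> measurable_fun setT g ->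
  measurable [set x | f x < g x].
Proof.
move=> mf mg; rewrite -[X in measurable X]setTI.
have := measurable_fun_ltr mf mg.
by move=> /(_ measurableT [set true]); apply.
Qed.

Lemma measurable_set_ler (R : realType) d (T : measurableType d) (f g : T -> R) :
  measurable_fun setT f -> measurable_fun setT g ->
  measurable [set x | f x <= g x].
Proof.
move=> mf mg; rewrite -[X in measurable X]setTI.
have := measurable_fun_ler mf mg.
by move=> /(_ measurableT [set true]); apply.
Qed.

Lemma measurable_preimageT d1 d2 (T1 : measurableType d1) (T2 : measurableType d2)
    (f : T1 -> T2) (A : set T2) :
  measurable_fun setT f -> measurable A -> measurable (f @^-1` A).
Proof. by move=> mf mA; rewrite -[X in measurable X]setTI; exact: mf. Qed.

(** * Conditional laws: joint laws and null events *)

Section conditional_law.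
Context (R : realType) d d1 (T : measurableType d) (T1 : measurableType d1).
Variables (P : probability T R) (Z : T -> T1).
Hypothesis mZ : measurable_fun setT Z.

(** On a rectangle both probabilities are the same integral of the common kernel; rectangles form a
    generating system stable under intersection, so the two joint laws coincide. *)
Lemma cond_law_pair_ext d2 (T2 : measurableType d2) (U V : T -> T2)
    (F G : R.-pker T1 ~> T2) :
  measurable_fun setT U -> measurable_fun setT V ->
  is_cond_law P Z U F -> is_cond_law P Z V G ->
  (forall z, F z = G z :> (set T2 -> \bar R)) ->
  forall E, measurable E ->
    P [set w | E (Z w, U w)] = P [set w | E (Z w, V w)].
Proof.
move=> mU mV PU PV FG E mE.
have mZU := measurable_fun_pair mZ mU.
have mZV := measurable_fun_pair mZ mV.
pose f : {mfun T >-> (T1 * T2)%type} := mfun_Sub (mem_set mZU).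
pose g : {mfun T >-> (T1 * T2)%type} := mfun_Sub (mem_set mZV).
apply: (measure_unique [set A `*` B | A in measurable & B in measurable]
  (fun=> setT) _ _ _ _ (distribution P f) (distribution P g)) => //.
- exact: measurable_prod_measurableType.
- move=> _ _ [A mA [B mB <-]] [A' mA' [B' mB' <-]].
  exists (A `&` A'); first exact: measurableI.
  by exists (B `&` B'); [exact: measurableI|rewrite setXI].
- by move=> _; exists setT => //; exists setT => //; rewrite setXTT.
- by rewrite bigcup_const.
- move=> _ [A mA [B mB <-]].
  change (P (Z @^-1` A `&` U @^-1` B) = P (Z @^-1` A `&` V @^-1` B)).
  by rewrite PU// PV//; apply: eq_integral => w _; rewrite FG.
- by move=> _; rewrite (le_lt_trans (probability_le1 _ _))// ltry.
Qed.

(** The probability of the rectangle is the integral over [A] of an almost surely positive function;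
    such an integral vanishes only over a null set. *)
Lemma cond_law_rectangle_null d2 (T2 : measurableType d2) (V : T -> T2)
    (F : R.-pker T1 ~> T2) (A : set T1) (B : set T2) :
  is_cond_law P Z V F -> measurable A -> measurable B ->
  {ae P, forall w, 0 < F (Z w) B}%E ->
  P (Z @^-1` A `&` V @^-1` B) = 0%E -> P (Z @^-1` A) = 0%E.
Proof.
move=> PV mA mB F0 PAB0.
have mZA : measurable (Z @^-1` A) by exact: measurable_preimageT.
have mF : measurable_fun (Z @^-1` A) (fun w => F (Z w) B).
  apply: (@measurable_funTS) => //.
  exact: (measurableT_comp (measurable_kernel F B mB) mZ).
have /(ae_eq_integral_abs P mZA mF) F_eq0 :
    (\int[P]_(w in Z @^-1` A) `|F (Z w) B| = 0)%E.
  rewrite -PAB0 PV//; apply: eq_integral => w _.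
  by rewrite gee0_abs.
apply/negligibleP => //.
apply: negligibleS (filterI F0 F_eq0) => w Aw /= [].
by move=> + /(_ Aw) F0w; rewrite F0w ltxx.
Qed.

(* Rectangles suffice: where [t1 < t2] two rationals fit between them, so the
   event is a countable union of rectangles. *)
Lemma cond_law_itv_null (V : T -> R) (F : R.-pker T1 ~> R) (A : set T1)
    (t1 t2 : T1 -> R) :
  is_cond_law P Z V F -> measurable_fun setT V ->
  (forall a b, a < b -> {ae P, forall w, 0 < F (Z w) `]a, b[%classic}%E) ->
  measurable A -> measurable_fun setT t1 -> measurable_fun setT t2 ->
  (forall z, A z -> t1 z < t2 z) ->
  P.-negligible [set w | [/\ A (Z w), t1 (Z w) < V w & V w < t2 (Z w)]] ->
  P.-negligible (Z @^-1` A).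
Proof.
move=> PV mV F0 mA mt1 mt2 t12 P0.
(* An enumeration of the rationals by naturals; codes of no rational go to the harmless default
   0. *)
pose r n : R := ratr (odflt 0 (@unpickle rat n)).
have r_dense (a b : R) : a < b -> exists n, a < r n < b.
  move=> /rat_in_itvoo[q]; rewrite in_itv/= => qab.
  by exists (pickle q); rewrite /r pickleK.
pose Ar m n := A `&` [set z | t1 z < r m] `&` [set z | r n < t2 z].
have mAr m n : measurable (Ar m n).
  by apply: measurableI; [apply: measurableI => //|];
    apply: measurable_set_ltr.
have Ar0 m n : r m < r n -> P (Z @^-1` Ar m n) = 0%E.
  move=> rmn.
  apply: (cond_law_rectangle_null PV (mAr m n) _ (F0 _ _ rmn)) => //.
  apply/negligibleP; first by apply: measurableI; exact: measurable_preimageT.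
  apply: negligibleS P0 => w /= [[[Aw t1w] t2w]]; rewrite in_itv/= => /andP[qV Vq].
  by split=> //; [exact: lt_trans qV|exact: lt_trans t2w].
(* Pairs in the wrong order contribute the empty set, so the union may run over all [m] and [n]. *)
pose N m n : set T := if r m < r n then Z @^-1` Ar m n else set0.
have N0 m n : P.-negligible (N m n).
  rewrite /N; case: ifPn => [rmn|_]; last exact: negligible_set0.
  by apply/negligibleP; [exact: measurable_preimageT|exact: Ar0].
apply: negligibleS (negligible_bigcup (fun m => negligible_bigcup (N0 m))).
move=> w /= Aw.
have [m /andP[t1m rt2]] := r_dense _ _ (t12 _ Aw).
have [n /andP[rmn nt2]] := r_dense _ _ rt2.
by exists m => //; exists n => //; rewrite /N rmn.
Qed.

End conditional_law.

(** * Measurability of row vectors and linear forms *)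

Section row_measurability.
Context d (T : measurableType d).

Lemma measurable_row_coord d' (S : sigmaRingType d') n (i : 'I_n) :
  measurable_fun setT (fun x : 'rV[S]_n => x ord0 i).
Proof.
move=> _ Y mY; rewrite setTI; apply: sub_sigma_algebra => /=.
rewrite -bigcup_seq/=; exists i => /=; first by rewrite mem_index_enum.
by exists Y => //; rewrite setTI.
Qed.

Lemma measurable_fun_row d' (S : measurableType d') n (f : T -> 'rV[S]_n) :
  (forall i, measurable_fun setT (fun w => f w ord0 i)) -> measurable_fun setT f.
Proof.
move=> mf _ Y mY; rewrite setTI.
suff : <<s \big[setU/set0]_(i < n)
    preimage_set_system setT (fun x : 'rV[S]_n => x ord0 i) measurable >> `<=`
    [set B | measurable (f @^-1` B)] by apply.
apply: smallest_sub => [|B].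
  split => /= [|B mB|F mF].
  - by rewrite preimage_set0.
  - by rewrite setTD -preimage_setC; exact: measurableC.
  - by rewrite preimage_bigcup; exact: bigcup_measurable.
rewrite -bigcup_seq/= => -[i _ [A mA <-]].
by rewrite setTI -comp_preimage; exact: (measurable_preimageT (mf i)).
Qed.

Variables (R : realType) (n : nat).

Lemma measurable_mulmx_col (f : T -> 'rV[R]_n) (b : 'cV[R]_n) :
  measurable_fun setT f ->
  measurable_fun setT (fun w => (f w *m b) ord0 ord0).
Proof.
move=> mf; rewrite (_ : (fun w => _) =
    fun w => \sum_(j < n) f w ord0 j * b j ord0); last first.
  by apply/funext => w; rewrite mxE.
apply: measurable_sum => j.
apply: measurable_funM; last exact: measurable_cst.
exact: (measurableT_comp (measurable_row_coord j) mf).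
Qed.

End row_measurability.

(** * Generalized inverses as real thresholds *)

(** The two existence hypotheses make the upper level set nonempty and bounded below, so its infimum
    is real; right continuity makes that infimum attained, and monotonicity makes the set a closed
    half-line. *)
Lemma ginv_level (R : realType) (K : nat) (s : flt_structure R K) t (y : R) :
  {homo h s t : x z / x <= z} -> right_continuous (h s t) ->
  (exists x, y <= h s t x) -> (exists x, h s t x < y) ->
  exists c, ginv s t y = c%:E /\ forall x, (y <= h s t x) = (c <= x).
Proof.
move=> hmono hcont [x0 yx0] [x1 x1y].
pose A := [set x | y <= h s t x].
have A0 : A !=set0 by exists x0.
have lbA : has_lbound A.
  exists x1 => x Ax; rewrite leNgt; apply/negP => /ltW/hmono.
  by rewrite leNgt (lt_le_trans x1y).
exists (inf A); split.
  rewrite /ginv; case: (pselect _) => [A_eq0|An0]; last by rewrite ereal_inf_EFin.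
  by exfalso; have : A x0 := yx0; rewrite /A A_eq0.
move=> x; apply/idP/idP => [Ax|infAx]; first exact: ge_inf.
apply: (@le_trans _ _ (h s t (inf A))); last exact: hmono.
(* If [h] were below [y] at the infimum, right continuity would keep it below on an interval to the
   right, where the infimum property provides a point of [A]. *)
rewrite leNgt; apply/negP => hinfy.
have [e /= e0 he] := cvgr_lt _ (hcont (inf A)) _ hinfy.
have [a Aa ainf] := inf_adherent e0 (conj A0 lbA).
have := ge_inf lbA Aa; rewrite le_eqVlt => /predU1P[infa|infa].
  by move: hinfy; rewrite infa ltNge (Aa : y <= _).
suff /he /(_ infa) : ball_ Num.norm (inf A) e a.
  by rewrite /= ltNge (Aa : y <= _).
by rewrite /ball_/= ltr0_norm ?subr_lt0// opprB ltrBlDl.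
Qed.

Definition at_period (A : Type) t (x : A * A) : A :=
  match t with T1 => x.1 | T2 => x.2 end.

(** * Sign restrictions from observational equivalence *)

Section sign_restrictions.
Context (R : realType) (K : nat).
Implicit Types (s : flt_structure R K) (t : period).
Implicit Types (b : 'cV[R]_K) (c : period -> R).

(* The fixed effect is left out: it cancels between the two periods. *)
Definition index b c t (x : 'rV[R]_K * 'rV[R]_K) : R :=
  (at_period t x *m b) ord0 ord0 - c t.

Definition regressors (w : outcome R K) : 'rV[R]_K * 'rV[R]_K := w.1.2.

Lemma measurable_at_period d (T : measurableType d) t :
  measurable_fun setT (fun x : T * T => at_period t x).
Proof. by case: t; [exact: measurable_fst|exact: measurable_snd]. Qed.

Lemma measurable_index b c t : measurable_fun setT (index b c t).
Proof.
apply: measurable_funB; last exact: measurable_cst.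
by apply: measurable_mulmx_col; exact: measurable_at_period.
Qed.

Lemma measurable_alphaX : measurable_fun setT (@alphaX R K).
Proof.
rewrite (_ : @alphaX R K = fst); first exact: measurable_fst.
by apply/funext => -[[a [x1 x2]] u].
Qed.

Lemma measurable_regressors : measurable_fun setT regressors.
Proof. exact: (measurableT_comp measurable_snd measurable_fst). Qed.

Lemma measurable_U t : measurable_fun setT (@U R K t).
Proof.
rewrite (_ : U t = fun w : outcome R K => at_period t w.2); last by case: t.
exact: (measurableT_comp (measurable_at_period t) measurable_snd).
Qed.

Lemma measurable_alphaX_index b c t :
  measurable_fun setT (fun z : R * ('rV[R]_K * 'rV[R]_K) => z.1 + index b c t z.2).
Proof.
apply: measurable_funD; first exact: measurable_fst.
exact: (measurableT_comp (measurable_index b c t) measurable_snd).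
Qed.

Lemma full_support_itv (mu : set R -> \bar R) (x y : R) :
  msupport mu = [set: R] -> x < y -> (0 < mu `]x, y[%classic)%E.
Proof.
move=> mu_full xy; have : msupport mu ((x + y) / 2) by rewrite mu_full.
apply; split; first exact: itv_open.
by rewrite /= in_itv/=; apply/andP; split; lra.
Qed.

Lemma A2_itv_null s t (A : set (R * ('rV[R]_K * 'rV[R]_K)))
    (l1 l2 : R * ('rV[R]_K * 'rV[R]_K) -> R) :
  A2 s -> measurable A -> measurable_fun setT l1 -> measurable_fun setT l2 ->
  (forall z, A z -> l1 z < l2 z) ->
  (law s).-negligible [set w | [/\ A (alphaX w), l1 (alphaX w) < U t w
                                 & U t w < l2 (alphaX w)]] ->
  (law s).-negligible (@alphaX R K @^-1` A).
Proof.
move=> [F [Fcond _ Ffull]].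
apply: (cond_law_itv_null measurable_alphaX (Fcond t) (measurable_U t)).
by move=> x y xy; apply: aeW => w; exact: full_support_itv.
Qed.

Lemma A2_exchange s t t' (E : set ((R * ('rV[R]_K * 'rV[R]_K)) * R)) :
  A2 s -> measurable E ->
  law s [set w | E (alphaX w, U t w)] = law s [set w | E (alphaX w, U t' w)].
Proof.
move=> [F [Fcond Feq _]] mE.
apply: (cond_law_pair_ext measurable_alphaX _ _ (Fcond t) (Fcond t')) => //;
  try exact: measurable_U.
by case: t t' => -[] z //; rewrite Feq.
Qed.

(* With [u = t] this is the event that X lies in C and Y_t is above the
   threshold of level [c t]. *)
Definition choice b c (C : set ('rV[R]_K * 'rV[R]_K)) t u : set (outcome R K) :=
  [set w | C (regressors w) /\ U u w <= alpha w + index b c t (regressors w)].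

Lemma measurable_choice b c C t u : measurable C ->
  measurable (choice b c C t u).
Proof.
move=> mC; apply: measurableI.
  exact: (measurable_preimageT measurable_regressors).
apply: measurable_set_ler; first exact: measurable_U.
exact: (measurableT_comp (measurable_alphaX_index b c t) measurable_fst).
Qed.

(** Stationarity of the errors given [alphaX] allows one period's error to replace the other's. With
    a common error, the events of the two periods are nested according to their indices. *)
Lemma choice_exchange s b c C t u u' : A2 s -> measurable C ->
  law s (choice b c C t u) = law s (choice b c C t u').
Proof.
move=> hA2 mC.
pose E := [set z : (R * ('rV[R]_K * 'rV[R]_K)) * R |
  C z.1.2 /\ z.2 <= z.1.1 + index b c t z.1.2].
have choiceE v : choice b c C t v = [set w | E (alphaX w, U v w)].
  by apply/seteqP; split=> -[[a [x1 x2]] e].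
rewrite !choiceE; apply: A2_exchange => //; apply: measurableI.
  apply: (measurable_preimageT _ mC).
  exact: (measurableT_comp measurable_snd measurable_fst).
apply: measurable_set_ler; first exact: measurable_snd.
exact: (measurableT_comp (measurable_alphaX_index b c t) measurable_fst).
Qed.

Lemma choice_mono s b c C t t' : A2 s -> measurable C ->
  (forall x, C x -> index b c t x <= index b c t' x) ->
  (law s (choice b c C t t) <= law s (choice b c C t' t'))%E.
Proof.
move=> hA2 mC Ctt'; rewrite (choice_exchange _ _ t' t' t)//.
apply: le_measure; rewrite ?inE; try exact: measurable_choice.
move=> w /= [Cw /le_trans Uw]; split=> //; apply: Uw.
by rewrite lerD2l Ctt'.
Qed.

(** Once both events use the same error they are nested, so the reverse inequality makes their
    difference null. That difference has the error between two distinct thresholds, which full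
    support charges unless [C] is null. *)
Lemma choice_strict s b c C t t' : A2 s -> measurable C ->
  (forall x, C x -> index b c t x < index b c t' x) ->
  (law s (choice b c C t' t') <= law s (choice b c C t t))%E ->
  (law s).-negligible (regressors @^-1` C).
Proof.
move=> hA2 mC Ctt'; rewrite (choice_exchange _ _ t' t' t)//.
set E := choice b c C t t; set E' := choice b c C t' t => le_E'E.
have mE : measurable E by exact: measurable_choice.
have mE' : measurable E' by exact: measurable_choice.
have EE' : E `<=` E'.
  move=> w /= [Cw /le_trans Uw]; split=> //; apply: Uw.
  by rewrite lerD2l ltW// Ctt'.
have D0 : law s (E' `\` E) = 0%E.
  rewrite measureD//; last by rewrite (le_lt_trans (probability_le1 _ _)) ?ltry.
  rewrite setIidr//; change (law s E' - law s E = 0)%E.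
  suff -> : law s E' = law s E by rewrite subee// fin_num_measure.
  apply/eqP; rewrite eq_le le_E'E/=.
  by apply: le_measure => //; rewrite inE.
have := @A2_itv_null s t [set z | C z.2] _ _ hA2
  (measurable_preimageT measurable_snd mC)
  (measurable_alphaX_index b c t) (measurable_alphaX_index b c t').
rewrite (_ : alphaX @^-1` _ = regressors @^-1` C); last first.
  by apply/seteqP; split=> -[[a [x1 x2]] u].
apply; first by move=> z /Ctt'; rewrite ltrD2l.
have : (law s).-negligible (E' `\` E).
  by apply/negligibleP => //; exact: measurableD.
apply: negligibleS => -[[a [x1 x2]] u] /= [Cx lt1 lt2].
split; first by split=> //; exact: ltW.
by case=> _; rewrite leNgt [X in ~~ X]lt1.
Qed.

(* That is, [c t] is the generalized inverse of [h s t] at [y t]. *)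
Definition levels s c (y : period -> R) :=
  forall t x, (y t <= h s t x) = (c t <= x).

Lemma obs_choice s c y C t : levels s c y ->
  obs_law s [set p | C p.2 /\ y t <= at_period t p.1] =
  law s (choice (beta s) c C t t).
Proof.
move=> lev; rewrite /obs_law /pushforward; congr (law s _).
apply/seteqP; split=> -[[a [x1 x2]] [u1 u2]];
  rewrite /choice /regressors /YX /=; case: t; rewrite /= /Y lev /Ystar /index/=;
  by rewrite /alpha/= => -[Cx le]; split => //; move: le; lra.
Qed.

Lemma measurable_obs_choice C y t : measurable C ->
  measurable [set p : (R * R) * ('rV[R]_K * 'rV[R]_K) |
    C p.2 /\ y <= at_period t p.1].
Proof.
move=> mC; rewrite (_ : [set p | _] = snd @^-1` C `&`
  [set p : (R * R) * ('rV[R]_K * 'rV[R]_K) | y <= at_period t p.1]) //.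
apply: measurableI; first exact: (measurable_preimageT measurable_snd).
apply: measurable_set_ler; first exact: measurable_cst.
exact: (measurableT_comp (measurable_at_period t) measurable_fst).
Qed.

(** On the disagreement set [C], [choice_mono] under [s'] orders the two choice probabilities one
    way. These are observable, so the order carries over to [s], where [choice_strict] forces [C] to
    be null. *)
Lemma sign_agreement s s' c c' y t t' :
  A2 s -> A2 s' -> obs_equiv s' s -> levels s c y -> levels s' c' y ->
  (law s).-negligible [set w |
    index (beta s) c t (regressors w) < index (beta s) c t' (regressors w) /\
    index (beta s') c' t' (regressors w) <= index (beta s') c' t (regressors w)].
Proof.
move=> hA2 hA2' equiv lev lev'.
pose C := [set x | index (beta s) c t x < index (beta s) c t' x] `&`
  [set x | index (beta s') c' t' x <= index (beta s') c' t x].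
have mC : measurable C.
  by apply: measurableI; [apply: measurable_set_ltr|apply: measurable_set_ler];
    exact: measurable_index.
have choice_eq u :
    law s (choice (beta s) c C u u) = law s' (choice (beta s') c' C u u).
  rewrite -(obs_choice _ _ lev) -(obs_choice _ _ lev') equiv//.
  exact: measurable_obs_choice.
apply: (@choice_strict s (beta s) c C t t') => //; first by move=> x [].
rewrite !choice_eq; apply: choice_mono => //.
by move=> x [].
Qed.

End sign_restrictions.

(** * Affine forms that agree in sign, and positive densities *)

Lemma not_negligible_setT (R : realType) d (T : measurableType d)
    (P : probability T R) : ~ P.-negligible setT.
Proof.
move=> /(negligibleP _ measurableT) P0.
have : (0 = 1 :> \bar R)%E by rewrite -P0; exact: probability_setT.
by move/eqP; rewrite eq_sym onee_eq0.
Qed.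

(* Writing [v = b x + a(z)], [v' = b' x + a'(z)], [D = b a' - b' a] and
   [y = x + a / b], one has [v v' = y (D + b b' y)]: unless D = 0 this is
   negative on an interval of y's having 0 as an end point. *)
Lemma affine_sign (R : realType) d d1 (T : measurableType d)
    (T1 : measurableType d1) (P : probability T R) (Z : T -> T1) (V : T -> R)
    (G : R.-pker T1 ~> R) (b b' : R) (a a' : T1 -> R) :
  measurable_fun setT Z -> measurable_fun setT V -> is_cond_law P Z V G ->
  (forall x y, x < y -> {ae P, forall w, 0 < G (Z w) `]x, y[%classic}%E) ->
  measurable_fun setT a -> measurable_fun setT a' -> b != 0 ->
  P.-negligible [set w | b * V w + a (Z w) != 0 /\
    (b * V w + a (Z w)) * (b' * V w + a' (Z w)) <= 0] ->
  0 < b * b' /\ P.-negligible [set w | b * a' (Z w) - b' * a (Z w) != 0].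
Proof.
move=> mZ mV PV G0 ma ma' b0 P0.
have null (A : set T1) t1 t2 := cond_law_itv_null (A := A) (t1 := t1) (t2 := t2)
  mZ PV mV G0.
pose D z := b * a' z - b' * a z.
(* [r] is the root of the first form, so y = x - [r z]. The radius [e] is chosen so that |y| < [e z]
   implies |b b' y| <= |D|; the 1 added to the denominator covers b b' = 0. *)
pose r z := - a z / b.
pose e z := `|D z| / (`|b * b'| + 1).
have mD : measurable_fun setT D.
  by apply: measurable_funB; apply: measurable_funM => //; exact: measurable_cst.
have mr : measurable_fun setT r.
  apply: measurable_funM; last exact: measurable_cst.
  exact: measurableT_comp.
have me : measurable_fun setT e.
  apply: measurable_funM; last exact: measurable_cst.
  exact: measurableT_comp.
have vE x z : b * x + a z = b * (x - r z) by rewrite /r; field.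
have vvE x z : (b * x + a z) * (b' * x + a' z) =
    (x - r z) * (D z + b * b' * (x - r z)) by rewrite /r /D; field.
have m1 : 0 < `|b * b'| + 1 by rewrite ltr_wpDl.
have e_gt0 z : D z != 0 -> 0 < e z by move=> Dz; rewrite divr_gt0// normr_gt0.
have e_small z y : `|y| < e z -> `|b * b' * y| <= `|D z|.
  rewrite /e ltr_pdivlMr// (normrM (b * b')) => ye.
  have := normr_ge0 y; lra.
have mcmp0 (f : T1 -> R) : measurable_fun setT f ->
    measurable [set z | f z < 0] /\ measurable [set z | 0 < f z].
  by move=> mf; split; apply: measurable_set_ltr => //; exact: measurable_cst.
(* For 0 < y < [e z] the factor D + b b' y stays nonpositive, so the band lies in the null event.
   The case of positive D uses the mirror band -[e z] < y < 0. *)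
have Dneg : P.-negligible (Z @^-1` [set z | D z < 0]).
  apply: (null _ r (fun z => r z + e z)) => //.
  - exact: (mcmp0 _ mD).1.
  - exact: measurable_funD.
  - by move=> z /= Dz; rewrite ltrDl e_gt0// lt_eqF.
  apply: negligibleS P0 => w /= [Dz rV Ve].
  have y0 : 0 < V w - r (Z w) by rewrite subr_gt0.
  split; first by rewrite vE mulf_neq0// gt_eqF.
  have := e_small (Z w) (V w - r (Z w)).
  rewrite vvE (gtr0_norm y0) (ltr0_norm Dz) ltrBlDl => /(_ Ve).
  have := ler_norm (b * b' * (V w - r (Z w))).
  move=> h1 h2; rewrite pmulr_rle0//; lra.
have Dpos : P.-negligible (Z @^-1` [set z | 0 < D z]).
  apply: (null _ (fun z => r z - e z) r) => //.
  - exact: (mcmp0 _ mD).2.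
  - exact: measurable_funB.
  - by move=> z /= Dz; rewrite ltrBlDr ltrDl e_gt0// gt_eqF.
  apply: negligibleS P0 => w /= [Dz rV Ve].
  have y0 : V w - r (Z w) < 0 by rewrite subr_lt0.
  split; first by rewrite vE mulf_neq0// lt_eqF.
  have := e_small (Z w) (V w - r (Z w)).
  rewrite vvE (ltr0_norm y0) (gtr0_norm Dz) opprB ltrBlDl -ltrBlDr => /(_ rV).
  have := lerNnormlW (lexx `|b * b' * (V w - r (Z w))|).
  move=> h1 h2; rewrite nmulr_rle0//; lra.
have D0 : P.-negligible [set w | D (Z w) != 0].
  apply: negligibleS (negligibleU Dneg Dpos) => w /=.
  by rewrite neq_lt => /orP[]; [left|right].
split=> //; rewrite ltNge; apply/negP => bb'.
(* Where D = 0 the product is b b' y^2, nonpositive if b b' <= 0; any band to the right of the root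
   then works, here one of width 1. *)
have D0' : P.-negligible (Z @^-1` [set z | D z = 0]).
  apply: (null _ r (fun z => r z + 1)) => //.
  - rewrite (_ : [set z | _] = ~` ([set z | D z < 0] `|` [set z | 0 < D z])).
      by apply: measurableC; apply: measurableU;
        [exact: (mcmp0 _ mD).1|exact: (mcmp0 _ mD).2].
    apply/seteqP; split=> z /= => [->|]; first by rewrite ltxx => -[].
    by move=> Dz; apply/eqP/negPn; rewrite neq_lt; apply/negP => /orP.
  - by apply: measurable_funD => //; exact: measurable_cst.
  - by move=> z _; rewrite ltrDl.
  apply: negligibleS P0 => w /= [Dz rV _].
  have y0 : 0 < V w - r (Z w) by rewrite subr_gt0.
  split; first by rewrite vE mulf_neq0// gt_eqF.
  by rewrite vvE Dz add0r mulrCA -expr2 mulr_le0_ge0// sqr_ge0.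
apply: (@not_negligible_setT _ _ _ P).
apply: negligibleS (negligibleU D0 D0') => w _ /=.
by have [|] := eqVneq (D (Z w)) 0; [right|left].
Qed.

(** A zero integral of a positive density would make the interval Lebesgue null, against its length
    [y - x]. *)
Lemma pos_density_itv (R : realType) (mu : set R -> \bar R) (g : R -> R) (x y : R) :
  measurable_fun setT g -> (forall z, 0 < g z) ->
  (forall B, measurable B ->
    mu B = (\int[@lebesgue_measure R]_(z in B) (g z)%:E)%E) ->
  x < y -> (0 < mu `]x, y[%classic)%E.
Proof.
move=> mg g0 muE xy; rewrite muE//.
have ge0 : (0 <= \int[@lebesgue_measure R]_(z in `]x, y[%classic) (g z)%:E)%E.
  by apply: integral_ge0 => z _; rewrite lee_fin ltW.
rewrite lt_neqAle ge0 andbT; apply/negP => /eqP int0.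
have mI : measurable (`]x, y[%classic : set R) by exact: measurable_itv.
have mgE : measurable_fun (`]x, y[%classic : set R) (fun z => (g z)%:E).
  by apply: measurable_funTS; apply/measurable_EFinP.
have /(ae_eq_integral_abs (@lebesgue_measure R) mI mgE) g_eq0 :
    (\int[@lebesgue_measure R]_(z in `]x, y[%classic) `|(g z)%:E| = 0)%E.
  rewrite [RHS]int0; apply: eq_integral => z _.
  by rewrite gee0_abs// lee_fin ltW.
have : (@lebesgue_measure R).-negligible `]x, y[%classic.
  apply: negligibleS g_eq0 => z /= Iz /(_ Iz)[gz0].
  by have := g0 z; rewrite gz0 ltxx.
move=> /(negligibleP (@lebesgue_measure R) mI) mu0.
have muI : lebesgue_measure (`]x, y[%classic : set R) = (y - x)%:E.
  by rewrite lebesgue_measure_itv/= lte_fin xy EFinB.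
by have [] := etrans (esym mu0) muI; lra.
Qed.

Lemma mulmx_col'_row' (R : comRingType) n (x : 'rV[R]_n) (b : 'cV[R]_n) k :
  (x *m b) ord0 ord0 =
  b k ord0 * x ord0 k + (col' k x *m row' k b) ord0 ord0.
Proof.
rewrite !mxE (bigD1_ord k)//= mulrC; congr (_ + _).
by apply: eq_bigr => j _; rewrite !mxE.
Qed.

Lemma mulmx_col_continuous (R : realType) n (u : 'cV[R]_n) :
  continuous (fun v : 'rV[R]_n => (v *m u) ord0 ord0).
Proof.
rewrite (_ : (fun v => _) = fun v : 'rV[R]_n =>
    \sum_(j < n) v ord0 j * u j ord0); last by apply/funext => v; rewrite mxE.
apply: continuous_big => [|j _ v]; first exact: add_continuous.
have := @continuousM _ 'rV[R]_n (fun v => v ord0 j) (fun=> u j ord0) v.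
by apply; [exact: coord_continuous|exact: cst_continuous].
Qed.

(** * Thresholds under both structures and the rank condition *)

Section identification.
Context (R : realType) (K : nat).
Implicit Types s : flt_structure R K.

(** A value of [h s t] that bounds all others from below would be the infimum of the range, which
    [Yunder] excludes; hence some value lies strictly below [y] and [ginv_level] applies. *)
Lemma Yunder_level s t y : A1 s -> Yunder s t y ->
  exists c, ginv s t y = c%:E /\ forall x, (y <= h s t x) = (c <= x).
Proof.
move=> /(_ t)[hmono hcont _] [[x0 _ <-] yinf]; apply: ginv_level => //.
  by exists x0.
apply: contrapT => /forallNP hge; apply: yinf; apply/eqP; rewrite eq_le.
apply/andP; split.
  apply: le_ereal_inf_tmp => _ [_ [x _ <-] <-]; rewrite lee_fin leNgt.
  exact/negP/hge.
by apply: ereal_inf_lbound; exists (h s t x0) => //; exists x0.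
Qed.

(** The larger of two distinct values exceeds the infimum. This gives access to the normalization of
    [beta], which [A4] states only at thresholds in [Yunder]. *)
Lemma Yunder_nonempty s t : A1 s -> exists y, Yunder s t y.
Proof.
move=> /(_ t)[_ _ hnc].
have [x0 [x1 lt01]] : exists x0 x1, h s t x0 < h s t x1.
  apply: contrapT => /forallNP hN; apply: hnc; exists (h s t 0) => x.
  apply/eqP; rewrite eq_le !leNgt; apply/andP; split; apply/negP => lt0;
    [apply: (hN 0)|apply: (hN x)]; by [exists x|exists 0].
exists (h s t x1); split; first by exists x1.
apply/eqP; rewrite gt_eqF//.
apply: (@le_lt_trans _ _ (h s t x0)%:E); last by rewrite lte_fin.
by apply: ereal_inf_lbound; exists (h s t x0) => //; exists x0.
Qed.

(* Under s, hence under s', {Y_t >= y_t} has probability strictly between 0 and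
   1, so that the generalized inverse of [h s' t] at [y t] is a genuine level. *)
Lemma obs_level s s' c y t :
  A2 s -> A1 s' -> obs_equiv s' s -> levels s c y ->
  exists c', ginv s' t (y t) = c'%:E /\
    forall x, (y t <= h s' t x) = (c' <= x).
Proof.
move=> hA2 /(_ t)[hmono hcont _] equiv lev.
pose E : set ((R * R) * ('rV[R]_K * 'rV[R]_K)) :=
  [set p | setT p.2 /\ y t <= at_period t p.1].
have mE : measurable E by exact: measurable_obs_choice.
pose C := choice (beta s) c setT t t.
have mC : measurable C by exact: measurable_choice.
have obsE : law s (YX s @^-1` E) = law s C by exact: obs_choice.
have obsE' : law s' (YX s' @^-1` E) = law s C.
  by rewrite -obsE; exact: equiv.
have YE w : at_period t (YX s' w).1 = Y s' t w by case: (t).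
pose l z := z.1 + index (beta s) c t z.2.
have ml : measurable_fun setT l by exact: measurable_alphaX_index.
(* By full support, an event containing a whole band of errors is not null. It is applied to [C]
   with the unit band below the threshold [l], and to its complement with the unit band above
   [l]. *)
have itv_notnull (l1 l2 : R * ('rV[R]_K * 'rV[R]_K) -> R) (A : set (outcome R K)) :
    measurable_fun setT l1 -> measurable_fun setT l2 -> (forall z, l1 z < l2 z) ->
    (forall w, l1 (alphaX w) < U t w -> U t w < l2 (alphaX w) -> A w) ->
    measurable A -> law s A <> 0%E.
  move=> ml1 ml2 l12 l12A mA /(negligibleP _ mA) A0.
  apply: (@not_negligible_setT _ _ _ (law s)).
  apply: (A2_itv_null (t := t) hA2 measurableT ml1 ml2) => //.
  by apply: negligibleS A0 => w [_]; exact: l12A.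
apply: ginv_level => //.
- apply: contrapT => /forallNP hlt.
  apply: (itv_notnull (fun z => l z - 1) l C) => //.
  + by apply: measurable_funB => //; exact: measurable_cst.
  + by move=> z; rewrite ltrBlDr ltrDl.
  + by move=> [[a [x1 x2]] u] _ /ltW.
  rewrite -obsE' (_ : _ @^-1` _ = set0) ?measure0//.
  by rewrite -subset0 => w [_]; rewrite YE => /hlt.
- apply: contrapT => /forallNP hge.
  apply: (itv_notnull l (fun z => l z + 1) (~` C)) => //.
  + by apply: measurable_funD => //; exact: measurable_cst.
  + by move=> z; rewrite ltrDl.
  + by move=> [[a [x1 x2]] u] lt1 _ [_]; rewrite leNgt [X in ~~ X]lt1.
  + exact: measurableC.
  rewrite probability_setC// -obsE' (_ : _ @^-1` _ = setT).
    by rewrite probability_setT subee.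
  apply/seteqP; split=> // w _; split=> //; rewrite YE leNgt.
  exact/negP/hge.
Qed.

Lemma measurable_X t : measurable_fun setT (@X R K t).
Proof.
rewrite (_ : X t = fun w : outcome R K => at_period t (regressors w)).
  exact: (measurableT_comp (measurable_at_period t) (@measurable_regressors R K)).
by case: t.
Qed.

Lemma measurable_DeltaX : measurable_fun setT (@DeltaX R K).
Proof.
apply: measurable_fun_row => i; under eq_fun do rewrite !mxE.
by apply: measurable_funB;
  exact: (measurableT_comp (measurable_row_coord i) (measurable_X _)).
Qed.

Lemma measurable_W : measurable_fun setT (@W R K).
Proof.
apply: measurable_fun_row => i; rewrite /W.
case: (splitP i) => j ij.
  rewrite (_ : i = lshift 1 j); last exact: val_inj.
  under eq_fun do rewrite row_mxEl.
  exact: (measurableT_comp (measurable_row_coord j) measurable_DeltaX).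
rewrite (_ : i = rshift K j); last exact: val_inj.
by under eq_fun do rewrite row_mxEr mxE; exact: measurable_cst.
Qed.

(** The vectors orthogonal to [u] form a subspace whose complement is open and, by hypothesis, null
    for the law of [W]; so it contains the support of [W]. By the rank condition it is the whole
    space, hence [u] vanishes. *)
Lemma A3ii_orthogonal s (u : 'cV[R]_(K + 1)) : A3ii s ->
  (law s).-negligible [set w | (W w *m u) ord0 ord0 != 0] -> u = 0.
Proof.
move=> hA3 null_u; pose V := lker (linfun (mulmxr u : 'rV[R]_(K + 1) -> 'M[R]_1)).
have VE v : (v \in V) = ((v *m u) ord0 ord0 == 0).
  rewrite memv_ker lfunE/=; apply/eqP/eqP => [->|vu0]; first by rewrite mxE.
  by apply/matrixP => i j; rewrite !ord1 vu0 mxE.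
have [Vfull|/eqP Vproper] := eqVneq V fullv.
  apply/matrixP => i j; rewrite ord1 mxE.
  have : delta_mx ord0 i \in V by rewrite Vfull memvf.
  by rewrite VE -rowE mxE => /eqP.
exfalso; apply: (hA3 V Vproper) => v vsupp /=; rewrite VE.
apply/negPn/negP => vu0.
pose O := [set v : 'rV[R]_(K + 1) | (v *m u) ord0 ord0 != 0].
have oO : open O.
  apply: (@open_comp _ _ _ [set x | x != 0]); last exact: open_neq.
  by move=> x _; exact: mulmx_col_continuous.
have := vsupp O (conj oO vu0); rewrite /pushforward.
suff -> : law s (W @^-1` O) = 0%E by rewrite ltxx.
apply/negligibleP => //.
rewrite (_ : W @^-1` O = ~` (fun w => (W w *m u) ord0 ord0) @^-1` [set 0]).
  apply: measurableC; apply: measurable_preimageT => //.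
  by apply: measurable_mulmx_col; exact: measurable_W.
by apply/seteqP; split=> w /= /eqP.
Qed.

End identification.

(** * Proportionality of the parameter vectors, then normalization *)

Theorem theorem1 (R : realType) (K : nat) (s : flt_structure R K)
    (hs : admissible s) (y1 y2 : R)
    (hy1 : Yunder s T1 y1) (hy2 : Yunder s T2 y2) :
  identified_at s (fun s' => theta s' y1 y2).
Proof.
case: hs => hA1 hA2 [[k [bk0 [G [Gcond Gpos]]]] hA3ii] hA4.
move=> s' [hA1' hA2' _ hA4'] equiv.
pose y t := match t with T1 => y1 | T2 => y2 end.
have [c1 [gc1 lev1]] := Yunder_level hA1 hy1.
have [c2 [gc2 lev2]] := Yunder_level hA1 hy2.
pose c t := match t with T1 => c1 | T2 => c2 end.
have lev : levels s c y by case.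
have [c1' [gc1' lev1']] := obs_level T1 hA2 hA1' equiv lev.
have [c2' [gc2' lev2']] := obs_level T2 hA2 hA1' equiv lev.
pose c' t := match t with T1 => c1' | T2 => c2' end.
have lev' : levels s' c' y by case.
(* The two orders of the periods treat W theta > 0 and W theta < 0 respectively. *)
have null12 := sign_agreement T1 T2 hA2 hA2' equiv lev lev'.
have null21 := sign_agreement T2 T1 hA2 hA2' equiv lev lev'.
(* W theta is written as an affine function of the [k]-th component of [DeltaX] given the others,
   the form required by [affine_sign]. *)
have index_diff (b : 'cV[R]_K) d w :
    index b d T2 (regressors w) - index b d T1 (regressors w) =
    b k ord0 * DeltaX w ord0 k +
    ((col' k (DeltaX w) *m row' k b) ord0 ord0 - (d T2 - d T1)).
  rewrite addrA -mulmx_col'_row' /DeltaX mulmxBl /index !mxE/=; ring.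
have mDX := @measurable_DeltaX R K.
have ma (b : 'cV[R]_K) (e : R) : measurable_fun setT
    (fun z : 'rV[R]_K.-1 => (z *m row' k b) ord0 ord0 - e).
  apply: measurable_funB; last exact: measurable_cst.
  exact: measurable_mulmx_col.
have mZ : measurable_fun setT (fun w => col' k (@DeltaX R K w)).
  apply: measurable_fun_row => i; under eq_fun do rewrite mxE.
  exact: (measurableT_comp (measurable_row_coord _) mDX).
have Gitv (x z : R) : x < z ->
    {ae law s, forall w, 0 < G (col' k (DeltaX w)) `]x, z[%classic}%E.
  move=> xz; apply: filterS Gpos => w [g [mg g0 GE]].
  exact: (pos_density_itv mg g0 GE xz).
have [|bb'0 null_ba] := affine_sign (b' := beta s' k ord0) mZ
  (measurableT_comp (measurable_row_coord k) mDX) Gcond Gitv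
  (ma (beta s) (c2 - c1)) (ma (beta s') (c2' - c1')) bk0.
  apply: negligibleS (negligibleU null12 null21) => w /=.
  rewrite -(index_diff (beta s) c w) -(index_diff (beta s') c' w).
  rewrite subr_eq0 neq_lt => -[/orP[lt21|lt12] p]; [right|left]; split=> //.
    by move: p; rewrite nmulr_rle0 ?subr_lt0// subr_ge0.
  by move: p; rewrite pmulr_rle0 ?subr_gt0// subr_le0.
pose b := beta s k ord0; pose b' := beta s' k ord0.
(* [u] is b theta' - b' theta. Its [k]-th entry cancels, so W u is exactly the combination shown to
   vanish almost surely in [null_ba]. *)
pose u : 'cV[R]_(K + 1) := col_mx (b *: beta s' - b' *: beta s)
  (const_mx (b * (c2' - c1') - b' * (c2 - c1))).
have u0 : u = 0.
  apply: (A3ii_orthogonal hA3ii); apply: negligibleS null_ba => w /=.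
  apply: contra_neq => ba0.
  rewrite mul_row_col mulmxBr -!scalemxAr !mxE big_ord1 !mxE.
  have := mulmx_col'_row' (DeltaX w) (beta s) k.
  have := mulmx_col'_row' (DeltaX w) (beta s') k.
  rewrite !mxE => -> ->; move: ba0; rewrite !mxE /b /b' => ba0.
  by rewrite -[RHS]ba0; ring.
have /eq_col_mx[bb gg] : u = col_mx 0 0 by rewrite u0 col_mx0.
have beta_eq : b *: beta s' = b' *: beta s by apply/eqP; rewrite -subr_eq0 bb.
have gamma_eq : b * (c2' - c1') = b' * (c2 - c1).
  have /matrixP/(_ ord0 ord0) := gg; rewrite !mxE => /eqP.
  by rewrite subr_eq0 => /eqP.
have unit_norm (s0 : flt_structure R K) z1 z2 : A4 s0 -> Yunder s0 T1 z1 ->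
    Yunder s0 T2 z2 -> \sum_(j < K) beta s0 j ord0 ^+ 2 = 1.
  move=> h4 h1 h2; have [/= + _] := h4 _ _ h1 h2.
  rewrite /euclid_norm => n1; rewrite -[LHS]sqr_sqrtr ?n1 ?expr1n//.
  by apply: sumr_ge0 => j _; exact: sqr_ge0.
(* Both coefficient vectors have unit norm, so [beta_eq] gives equal squares; [bb'0] rules out
   opposite signs. *)
have bb' : b = b'.
  have [z1 hz1] := Yunder_nonempty T1 hA1'.
  have [z2 hz2] := Yunder_nonempty T2 hA1'.
  have sq : b ^+ 2 = b' ^+ 2.
    rewrite -[LHS]mulr1 -(unit_norm _ _ _ hA4' hz1 hz2).
    rewrite -[RHS]mulr1 -(unit_norm _ _ _ hA4 hy1 hy2) !mulr_sumr.
    apply: eq_bigr => j _; rewrite -!exprMn; congr (_ ^+ 2).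
    by have /matrixP/(_ j ord0) := beta_eq; rewrite !mxE.
  move/eqP: sq; rewrite eqf_sqr => /orP[/eqP//|/eqP bN].
  by move: bb'0; rewrite -/b -/b' bN; nra.
rewrite /theta /gamma gc1 gc2 gc1' gc2' -!EFinB; congr (_, _%:E).
  by apply: (scalerI bk0); rewrite beta_eq -bb'.
by apply: (mulfI bk0); rewrite -/b gamma_eq bb'.
Qed.
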